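(* For each ${}^{*}r\in({}^{*}\mathbb R_{\rm fin})^{\times}_{+}$, the map $\Phi_{{}^{*}r}:{}^{\star}\mathbb{PR}\to{}^{\star}\mathbb{PR}$, $\mu\mapsto\mu^{{}^{*}r}$, is an automorphism of the tropical semiring $({}^{\star}\mathbb{PR},+,\cdot)$, and the assignment ${}^{*}r\mapsto\Phi_{{}^{*}r}$ defines a faithful representation $\Phi:({}^{*}\mathbb R_{\rm fin})^{\times}_{+}\to\mathrm{Aut}({}^{\star}\mathbb{PR})$.
   Context: Fix a nonprincipal ultrafilter $\mathfrak u$ on $\mathbb N$ and let ${}^{*}\mathbb R=\mathbb R^{\mathbb N}/\mathfrak u$ be the ultrapower (sequences identified when they agree on a set of $\mathfrak u$; operations and order componentwise); elements are written ${}^{*}\{x_i\}$. ${}^{*}\mathbb R_{\rm fin}$ is the ring of classes of bounded sequences and $({}^{*}\mathbb R_{\rm fin})^{\times}_{+}$ the multiplicative group of positive elements of ${}^{*}\mathbb R$ that are neither infinite nor infinitesimal. The growth–decay semiring is ${}^{\star}\mathbb{PR}=({}^{*}\mathbb R_{+}\cup\{0\})/({}^{*}\mathbb R_{\rm fin})^{\times}_{+}$ (orbits under multiplication), totally ordered by comparing representatives, with product $\cdot$ induced by multiplication and tropical sum $\mu+\nu:=\max(\mu,\nu)$; the class of $0$ is denoted $-\infty$. For $\mu$ the class of ${}^{*}\{x_i\}$ and ${}^{*}r={}^{*}\{r_i\}\in({}^{*}\mathbb R_{\rm fin})^{\times}_{+}$, $\mu^{{}^{*}r}$ is the class of ${}^{*}\{x_i^{r_i}\}$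 (this is well defined). *)

(* Defs.v *)
From HB Require Import structures.
From mathcomp Require Import all_boot all_order all_algebra.
From mathcomp Require Import all_classical reals exp.

Set Implicit Arguments.
Unset Strict Implicit.
Unset Printing Implicit Defensive.

Import Order.TTheory GRing.Theory Num.Theory.

Local Open Scope classical_set_scope.
Local Open Scope ring_scope.
Local Open Scope quotient_scope.

Record ultrafilter := Ultrafilter {
  large : set_system nat;
  large_ultra : UltraFilter large }.

#[global] Instance large_ultraFilter (u : ultrafilter) : UltraFilter (large u) :=
  large_ultra u.

Definition nonprincipal (u : ultrafilter) : Prop :=
  forall n : nat, large u <> principal_filter n.

Section Hyperreal.
Context (R : realType) (u : ultrafilter).
Implicit Types (s t : nat -> R).

Definition agree s t : bool := `[< large u [set i | s i = t i] >].

Lemma agree_refl : reflexive agree.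
Proof. by move=> s; apply/asboolP; apply: nearW. Qed.

Lemma agree_sym : symmetric agree.
Proof.
by move=> s t; apply: asbool_equiv_eq; split; apply: filterS => i /= ->.
Qed.

Lemma agree_trans : transitive agree.
Proof.
move=> t s v /asboolP st /asboolP tv; apply/asboolP.
by move: st tv; apply: filterS2 => i /= -> ->.
Qed.

Canonical agree_equiv := EquivRel agree agree_refl agree_sym agree_trans.

Definition hyperreal : Type := {eq_quot agree}.

HB.instance Definition _ := Choice.on hyperreal.
HB.instance Definition _ := EqQuotient.on hyperreal.

Definition hclass s : hyperreal := \pi_hyperreal s.
Definition hrep (x : hyperreal) : nat -> R := repr x.

Lemma hrepK x : hclass (hrep x) = x.
Proof. exact: reprK. Qed.

Lemma hclassP s t : hclass s = hclass t <-> large u [set i | s i = t i].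
Proof.
split=> [/eqP|st]; first by rewrite piE => /asboolP.
by apply/eqP; rewrite piE; apply/asboolP.
Qed.

Lemma hrep_hclass s : large u [set i | hrep (hclass s) i = s i].
Proof. by apply/hclassP; rewrite hrepK. Qed.

Lemma hclassW (P : hyperreal -> Prop) : (forall s, P (hclass s)) -> forall x, P x.
Proof. by move=> Ps x; rewrite -[x]hrepK. Qed.

Definition hlift1 (f : R -> R) (x : hyperreal) : hyperreal :=
  hclass (fun i => f (hrep x i)).
Definition hlift2 (f : R -> R -> R) (x y : hyperreal) : hyperreal :=
  hclass (fun i => f (hrep x i) (hrep y i)).
Definition hrel (p : rel R) (x y : hyperreal) : bool :=
  `[< large u [set i | p (hrep x i) (hrep y i)] >].

Lemma hlift1E f s : hlift1 f (hclass s) = hclass (fun i => f (s i)).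
Proof. by apply/hclassP; apply: filterS (hrep_hclass s) => i /= ->. Qed.

Lemma hlift2E f s t :
  hlift2 f (hclass s) (hclass t) = hclass (fun i => f (s i) (t i)).
Proof.
by apply/hclassP; move: (hrep_hclass s) (hrep_hclass t); apply: filterS2 => i /= -> ->.
Qed.

Lemma hrelE p s t :
  hrel p (hclass s) (hclass t) = `[< large u [set i | p (s i) (t i)] >].
Proof.
apply: asbool_equiv_eq; split; move: (hrep_hclass s) (hrep_hclass t);
  by apply: filterS3 => i /= -> ->.
Qed.

Lemma near_ultra (P : nat -> Prop) :
  large u [set i | P i] \/ large u [set i | ~ P i].
Proof. exact: (in_ultra_setVsetC [set i | P i]). Qed.

Lemma near_absurd : ~ large u [set i | False].
Proof. by move=> /filter_ex []. Qed.

Fact haddA : associative (hlift2 +%R).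
Proof.
elim/hclassW=> s; elim/hclassW=> t; elim/hclassW=> v; rewrite !hlift2E.
by congr hclass; apply/funext => i; rewrite addrA.
Qed.
Fact haddC : commutative (hlift2 +%R).
Proof.
elim/hclassW=> s; elim/hclassW=> t; rewrite !hlift2E.
by congr hclass; apply/funext => i; rewrite addrC.
Qed.
Fact hadd0 : left_id (hclass (fun=> 0)) (hlift2 +%R).
Proof.
elim/hclassW=> s; rewrite !hlift2E.
by congr hclass; apply/funext => i; rewrite add0r.
Qed.
Fact haddN : left_inverse (hclass (fun=> 0)) (hlift1 -%R) (hlift2 +%R).
Proof.
elim/hclassW=> s; rewrite !hlift1E !hlift2E.
by congr hclass; apply/funext => i; rewrite addNr.
Qed.
HB.instance Definition _ := GRing.isZmodule.Build hyperreal haddA haddC hadd0 haddN.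

Fact hmulA : associative (hlift2 *%R).
Proof.
elim/hclassW=> s; elim/hclassW=> t; elim/hclassW=> v; rewrite !hlift2E.
by congr hclass; apply/funext => i; rewrite mulrA.
Qed.
Fact hmulC : commutative (hlift2 *%R).
Proof.
elim/hclassW=> s; elim/hclassW=> t; rewrite !hlift2E.
by congr hclass; apply/funext => i; rewrite mulrC.
Qed.
Fact hmul1 : left_id (hclass (fun=> 1)) (hlift2 *%R).
Proof.
elim/hclassW=> s; rewrite !hlift2E.
by congr hclass; apply/funext => i; rewrite mul1r.
Qed.
Fact hmulD : left_distributive (hlift2 *%R) (hlift2 +%R).
Proof.
elim/hclassW=> s; elim/hclassW=> t; elim/hclassW=> v; rewrite !hlift2E.
by congr hclass; apply/funext => i; rewrite mulrDl.
Qed.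
Fact hone_neq0 : hclass (fun=> 1) != 0.
Proof.
apply/eqP => /hclassP /filter_ex [_ /eqP]; exact/negP/oner_neq0.
Qed.
HB.instance Definition _ :=
  GRing.Zmodule_isComNzRing.Build hyperreal hmulA hmulC hmul1 hmulD hone_neq0.

Fact hmulV (x : hyperreal) : x != 0 -> hlift1 GRing.inv x * x = 1.
Proof.
elim/hclassW: x => s s0; rewrite hlift1E [LHS]hlift2E.
apply/hclassP; have [/hclassP s0'|] := near_ultra (fun i => s i = 0).
  by move: s0; rewrite s0' eqxx.
by apply: filterS => i /= /eqP si0; rewrite mulVf.
Qed.
Fact hinv0 : hlift1 GRing.inv 0 = 0.
Proof. by rewrite hlift1E; congr hclass; apply/funext => i; rewrite invr0. Qed.
HB.instance Definition _ := GRing.ComNzRing_isField.Build hyperreal hmulV hinv0.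

Definition hle : rel hyperreal := hrel <=%R.
Definition hlt : rel hyperreal := hrel <%R.

Fact hle0_add x y : hle 0 x -> hle 0 y -> hle 0 (x + y).
Proof.
elim/hclassW: x => s; elim/hclassW: y => t; rewrite [_ + _]hlift2E /hle !hrelE.
move=> /asboolP s0 /asboolP t0; apply/asboolP; move: s0 t0.
by apply: filterS2 => i /=; exact: addr_ge0.
Qed.
Fact hle0_mul x y : hle 0 x -> hle 0 y -> hle 0 (x * y).
Proof.
elim/hclassW: x => s; elim/hclassW: y => t; rewrite [_ * _]hlift2E /hle !hrelE.
move=> /asboolP s0 /asboolP t0; apply/asboolP; move: s0 t0.
by apply: filterS2 => i /=; exact: mulr_ge0.
Qed.
Fact hle0_anti x : hle 0 x -> hle x 0 -> x = 0.
Proof.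
elim/hclassW: x => s; rewrite /hle !hrelE.
move=> /asboolP s0 /asboolP t0; apply/hclassP; move: s0 t0.
by apply: filterS2 => i /= a b; apply/eqP; rewrite eq_le a b.
Qed.
Fact hsub_ge0 x y : hle 0 (y - x) = hle x y.
Proof.
elim/hclassW: x => s; elim/hclassW: y => t.
rewrite [- _]hlift1E [_ + _]hlift2E /hle !hrelE.
by apply: asbool_equiv_eq; split; apply: filterS => i /=; rewrite subr_ge0.
Qed.
Fact hle0_total x : hle 0 x || hle x 0.
Proof.
elim/hclassW: x => s; rewrite /hle !hrelE.
have [s0|s0] := near_ultra (fun i => 0 <= s i); apply/orP; [left|right];
  apply/asboolP => //.
by apply: filterS s0 => i /= /negP; rewrite -ltNge => /ltW.
Qed.
Fact hnormN x : hlift1 Num.norm (- x) = hlift1 Num.norm x.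
Proof.
elim/hclassW: x => s; rewrite [- _]hlift1E !hlift1E.
by congr hclass; apply/funext => i; rewrite normrN.
Qed.
Fact hge0_norm x : hle 0 x -> hlift1 Num.norm x = x.
Proof.
elim/hclassW: x => s; rewrite /hle hrelE hlift1E => /asboolP s0.
by apply/hclassP; apply: filterS s0 => i /=; exact: ger0_norm.
Qed.
Fact hlt_def x y : hlt x y = (y != x) && hle x y.
Proof.
elim/hclassW: x => s; elim/hclassW: y => t; rewrite /hlt /hle !hrelE.
apply/asboolP/andP => [st|[/eqP nts /asboolP st]].
  split; last by apply/asboolP; apply: filterS st => i /= /ltW.
  apply/eqP => /hclassP ts; apply: near_absurd; move: ts st.
  by apply: filterS2 => i /= ->; rewrite ltxx.
have [/hclassP//|ts] := near_ultra (fun i => t i = s i).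
by move: ts st; apply: filterS2 => i /= /eqP ts st; rewrite lt_neqAle eq_sym ts.
Qed.
HB.instance Definition _ := Num.IntegralDomain_isLeReal.Build hyperreal
  hle0_add hle0_mul hle0_anti hsub_ge0 hle0_total hnormN hge0_norm hlt_def.

Lemma hclass0 : 0 = hclass (fun=> 0). Proof. by []. Qed.
Lemma hclass1 : 1 = hclass (fun=> 1). Proof. by []. Qed.
Lemma hclassD s t : hclass s + hclass t = hclass (fun i => s i + t i).
Proof. exact: hlift2E. Qed.
Lemma hclassM s t : hclass s * hclass t = hclass (fun i => s i * t i).
Proof. exact: hlift2E. Qed.
Lemma hclassV s : (hclass s)^-1 = hclass (fun i => (s i)^-1).
Proof. exact: hlift1E. Qed.
Lemma hclass_norm s : `|hclass s| = hclass (fun i => `|s i|).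
Proof. exact: hlift1E. Qed.
Lemma hclass_le s t : (hclass s <= hclass t) = `[< large u [set i | s i <= t i] >].
Proof. exact: hrelE. Qed.
Lemma hclass_lt s t : (hclass s < hclass t) = `[< large u [set i | s i < t i] >].
Proof. exact: hrelE. Qed.
Lemma hclass_nat n : n%:R = hclass (fun=> n%:R).
Proof.
by elim: n => [|n IH] //; rewrite -natr1 IH hclass1 hclassD; congr hclass;
  apply/funext => i; rewrite natr1.
Qed.

(* Only used for nonnegative bases and positive exponents, where the values
   of [powR] at negative bases and at exponent 0 do not matter. *)
Definition hpow : hyperreal -> hyperreal -> hyperreal := hlift2 (@powR R).

Lemma hclass_pow s t : hpow (hclass s) (hclass t) = hclass (fun i => s i `^ t i).
Proof. exact: hlift2E. Qed.

End Hyperreal.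

Section GrowthDecay.
Context (R : realType) (u : ultrafilter).
Local Notation H := (hyperreal R u).
Implicit Types (x y z : H) (n : nat).

Definition hinfinite x : Prop := forall n, n%:R < `|x|.
Definition hinfinitesimal x : Prop := forall n, `|x| < n.+1%:R^-1.

(* Membership in the multiplicative group of positive hyperreals that are
   neither infinite nor infinitesimal. *)
Definition posfin x : bool :=
  `[< [/\ 0 < x, ~ hinfinite x & ~ hinfinitesimal x] >].

Lemma posfinP x :
  reflect (exists n, n.+1%:R^-1 <= x <= n.+1%:R) (posfin x).
Proof.
rewrite /posfin; apply: (iffP (asboolP _)) => [[x0 /existsNP [n xn] /existsNP [m xm]]|[n /andP[nx xn]]].
  move: xn xm => /negP; rewrite -leNgt gtr0_norm // => xn.
  move/negP; rewrite -leNgt => xm; exists (maxn n m); apply/andP; split.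
    by apply: le_trans xm; rewrite lef_pV2 ?posrE ?ltr0n// ler_nat ltnS leq_maxr.
  by apply: le_trans xn _; rewrite ler_nat ltnW // ltnS leq_maxl.
have x0 : 0 < x by apply: lt_le_trans nx; rewrite invr_gt0 ltr0n.
split=> // [/(_ n.+1)|/(_ n)]; rewrite gtr0_norm // ltNge.
  by rewrite xn.
by rewrite nx.
Qed.

Lemma posfin_gt0 x : posfin x -> 0 < x.
Proof. by move=> /asboolP[]. Qed.

Lemma posfin1 : posfin 1.
Proof. by apply/posfinP; exists 0; rewrite invr1 lexx. Qed.

Lemma posfinM x y : posfin x -> posfin y -> posfin (x * y).
Proof.
move=> px py; have x0 := posfin_gt0 px; have y0 := posfin_gt0 py.
move/posfinP: px => [n /andP[nx xn]]; move/posfinP: py => [m /andP[my ym]].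
apply/posfinP; exists (n.+1 * m.+1).-1; rewrite prednK ?muln_gt0 // natrM invfM.
by rewrite !ler_pM ?invr_ge0 ?ler0n // ltW.
Qed.

Lemma posfinV x : posfin x -> posfin x^-1.
Proof.
move=> px; have x0 := posfin_gt0 px; move/posfinP: px => [n /andP[nx xn]].
apply/posfinP; exists n; apply/andP; split.
  by rewrite lef_pV2 ?posrE ?ltr0n.
by rewrite -[leRHS]invrK lef_pV2 ?posrE ?invr_gt0 ?ltr0n.
Qed.

Record posFin := PosFin { posfin_val :> H; posfin_valP : posfin posfin_val }.

HB.instance Definition _ := [isSub for posfin_val].
HB.instance Definition _ := [Choice of posFin by <:].

Definition pf_one : posFin := PosFin posfin1.
Definition pf_mul (r s : posFin) : posFin :=
  PosFin (posfinM (posfin_valP r) (posfin_valP s)).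
Definition pf_inv (r : posFin) : posFin := PosFin (posfinV (posfin_valP r)).

Fact pf_mulA : associative pf_mul.
Proof. by move=> r s t; apply/val_inj; rewrite /= mulrA. Qed.
Fact pf_mul1 : left_id pf_one pf_mul.
Proof. by move=> r; apply/val_inj; rewrite /= mul1r. Qed.
Fact pf_mulr1 : right_id pf_one pf_mul.
Proof. by move=> r; apply/val_inj; rewrite /= mulr1. Qed.
Fact pf_mulV : left_inverse pf_one pf_inv pf_mul.
Proof.
move=> r; apply/val_inj; rewrite /= mulVf //.
by rewrite gt_eqF // posfin_gt0 ?posfin_valP.
Qed.
Fact pf_mulrV : right_inverse pf_one pf_inv pf_mul.
Proof.
move=> r; apply/val_inj; rewrite /= mulfV //.
by rewrite gt_eqF // posfin_gt0 ?posfin_valP.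
Qed.
HB.instance Definition _ :=
  isGroup.Build posFin pf_mulA pf_mul1 pf_mulr1 pf_mulV pf_mulrV.

Lemma posFin_gt0 (r : posFin) : 0 < (r : H).
Proof. exact: posfin_gt0 (posfin_valP r). Qed.

Record nnegH := NNegH { nneg_val :> H; nneg_valP : 0 <= nneg_val }.

HB.instance Definition _ := [isSub for nneg_val].
HB.instance Definition _ := [Choice of nnegH by <:].

Definition gorbit (x y : nnegH) : bool :=
  `[< exists c : posFin, (y : H) = (c : H) * (x : H) >].

Fact gorbit_refl : reflexive gorbit.
Proof. by move=> x; apply/asboolP; exists pf_one; rewrite mul1r. Qed.
Fact gorbit_sym : symmetric gorbit.
Proof.
move=> x y; apply: asbool_equiv_eq; split=> -[c ->]; exists (pf_inv c);
  by rewrite mulrA mulVf ?mul1r // gt_eqF // posFin_gt0.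
Qed.
Fact gorbit_trans : transitive gorbit.
Proof.
move=> y x z /asboolP[c yE] /asboolP[d zE]; apply/asboolP.
by exists (pf_mul d c); rewrite zE yE mulrA.
Qed.
Canonical gorbit_equiv := EquivRel gorbit gorbit_refl gorbit_sym gorbit_trans.

Definition growthDecay : Type := {eq_quot gorbit}.
Local Notation PR := growthDecay.

HB.instance Definition _ := Choice.on PR.
HB.instance Definition _ := EqQuotient.on PR.

Definition gclass (x : nnegH) : PR := \pi_PR x.
Definition grep (mu : PR) : nnegH := repr mu.

Lemma grepK mu : gclass (grep mu) = mu.
Proof. exact: reprK. Qed.

Lemma gclassP (x y : nnegH) :
  gclass x = gclass y <-> exists c : posFin, (y : H) = (c : H) * (x : H).
Proof.
split=> [/eqP|xy]; first by rewrite piE => /asboolP.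
by apply/eqP; rewrite piE; apply/asboolP.
Qed.

Lemma gclassW (P : PR -> Prop) : (forall x : nnegH, P (gclass x)) -> forall mu, P mu.
Proof. by move=> Px mu; rewrite -[mu]grepK. Qed.

Definition gle (mu nu : PR) : bool :=
  `[< exists x y : nnegH, [/\ gclass x = mu, gclass y = nu & (x : H) <= (y : H)] >].

(* Inequality of representatives depends on their choice inside equal classes,
   hence the existential quantifiers in [gle]; [gle_class] is the version for
   fixed representatives. *)
Lemma gle_class (x y : nnegH) :
  gle (gclass x) (gclass y) <-> exists c : posFin, (x : H) <= (c : H) * (y : H).
Proof.
split=> [/asboolP [x' [y' [/gclassP [c xE] /gclassP [d yE] xy]]]|[c xy]].
  exists (pf_mul c (pf_inv d)); rewrite xE yE /= -mulrA mulKf ?ler_pM2l //.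
    exact: posFin_gt0.
  by rewrite gt_eqF // posFin_gt0.
have cy0 : 0 <= (c : H) * (y : H) by rewrite mulr_ge0 ?nneg_valP // ltW // posFin_gt0.
apply/asboolP; exists x, (NNegH cy0); split=> //.
by apply/esym/gclassP; exists c.
Qed.

Fact gle_anti : antisymmetric gle.
Proof.
elim/gclassW => x; elim/gclassW => y /andP[/gle_class [c xy] /gle_class [d yx]].
apply/gclassP.
have [x0|x0] := eqVneq (x : H) 0.
  exists pf_one; rewrite x0 mulr0; apply/eqP; rewrite eq_le nneg_valP andbT.
  by rewrite (le_trans yx) // x0 mulr0.
have {}x0 : 0 < (x : H) by rewrite lt_neqAle eq_sym x0 nneg_valP.
have pf : posfin ((y : H) / (x : H)).
  have := posfin_valP (pf_inv c); have := posfin_valP d.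
  move=> /posfinP [n /andP[_ dn]] /posfinP [m /andP[mc _]].
  apply/posfinP; exists (maxn n m); apply/andP; split.
    rewrite ler_pdivlMr //; apply: (@le_trans _ _ (m.+1%:R^-1 * (x : H))).
      rewrite ler_pM2r // lef_pV2 ?posrE ?ltr0n // ler_nat ltnS leq_maxr //.
    apply: (@le_trans _ _ ((c : H)^-1 * (x : H))); first by rewrite ler_pM2r.
    by rewrite ler_pdivrMl // posFin_gt0.
  rewrite ler_pdivrMr //; apply: (le_trans yx); rewrite ler_pM2r //.
  by apply: (le_trans dn); rewrite ler_nat ltnS leq_maxl.
by exists (PosFin pf); rewrite /= divfK // gt_eqF.
Qed.
Fact gle_trans : transitive gle.
Proof.
elim/gclassW => y; elim/gclassW => x; elim/gclassW => z.
move=> /gle_class [c xy] /gle_class [d yz]; apply/gle_class.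
exists (pf_mul c d); apply: le_trans xy _.
by rewrite /= -mulrA ler_pM2l // posFin_gt0.
Qed.
Fact gle_refl : reflexive gle.
Proof. by elim/gclassW => x; apply/asboolP; exists x, x. Qed.
Fact gle_total : total gle.
Proof.
elim/gclassW => x; elim/gclassW => y.
by have [xy|/ltW yx] := leP (x : H) (y : H); apply/orP; [left|right];
  apply/asboolP; [exists x, y|exists y, x].
Qed.

(* The order gets its own display, so that it does not meet [ring_display]. *)
Fact gdisplay : Order.disp_t. Proof. exact: Order.default_display. Qed.

HB.instance Definition _ :=
  Order.Le_isPOrder.Build gdisplay PR gle_refl gle_anti gle_trans.
HB.instance Definition _ := Order.POrder_isTotal.Build gdisplay PR gle_total.

Definition nneg_mul (x y : nnegH) : nnegH :=
  NNegH (mulr_ge0 (nneg_valP x) (nneg_valP y)).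

(* The element written -oo, the zero of the semiring; [Order.max] is the
   tropical sum. *)
Definition gbot : PR := gclass (NNegH (lexx 0)).
Definition gone : PR := gclass (NNegH ler01).
Definition gadd (mu nu : PR) : PR := Order.max mu nu.
Definition gmul (mu nu : PR) : PR := gclass (nneg_mul (grep mu) (grep nu)).

(* [gmul] is independent of the representatives. *)
Lemma gmulE (x y : nnegH) : gmul (gclass x) (gclass y) = gclass (nneg_mul x y).
Proof.
have /gclassP [c xE] := grepK (gclass x); have /gclassP [d yE] := grepK (gclass y).
by apply/gclassP; exists (pf_mul c d); rewrite /= xE yE mulrACA.
Qed.

Fact gaddA : associative gadd. Proof. exact: maxA. Qed.
Fact gaddC : commutative gadd. Proof. exact: maxC. Qed.
Fact gadd0 : left_id gbot gadd.
Proof.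
elim/gclassW => x; apply/max_idPr; apply/asboolP.
by exists (NNegH (lexx 0)), x; split=> //; exact: nneg_valP.
Qed.
HB.instance Definition _ := GRing.isNmodule.Build PR gaddA gaddC gadd0.

Fact gmulA : associative gmul.
Proof.
elim/gclassW => x; elim/gclassW => y; elim/gclassW => z; rewrite !gmulE.
by congr gclass; apply/val_inj; rewrite /= mulrA.
Qed.
Fact gmulC : commutative gmul.
Proof.
elim/gclassW => x; elim/gclassW => y; rewrite !gmulE.
by congr gclass; apply/val_inj; rewrite /= mulrC.
Qed.
Fact gmul1 : left_id gone gmul.
Proof.
elim/gclassW => x; rewrite !gmulE.
by congr gclass; apply/val_inj; rewrite /= mul1r.
Qed.
Fact gmul0 : left_zero gbot gmul.
Proof.
elim/gclassW => x; rewrite !gmulE.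
by congr gclass; apply/val_inj; rewrite /= mul0r.
Qed.
Lemma gmul_homo rho : {homo gmul^~ rho : mu nu / (mu <= nu)%O}.
Proof.
elim/gclassW: rho => z; elim/gclassW => x; elim/gclassW => y /gle_class [c xy].
rewrite !gmulE; apply/gle_class; exists c; rewrite /= mulrA.
by rewrite ler_wpM2r // nneg_valP.
Qed.
Fact gmulD : left_distributive gmul gadd.
Proof.
move=> mu nu rho; rewrite /gadd; have [le|/ltW le] := leP mu nu.
  by rewrite max_r // gmul_homo.
by rewrite max_l // gmul_homo.
Qed.
Fact gone_neq0 : gone != 0.
Proof.
apply/eqP => /gclassP [c /= /esym/eqP]; rewrite mulr1 => /negPn.
by rewrite gt_eqF // posFin_gt0.
Qed.
HB.instance Definition _ :=
  GRing.Nmodule_isComNzSemiRing.Build PR gmulA gmulC gmul1 gmulD gmul0 gone_neq0.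

Fact hpow_ge0 x y : 0 <= hpow x y.
Proof.
elim/hclassW: x => s; elim/hclassW: y => t; rewrite hclass_pow hclass0 hclass_le.
by apply/asboolP; apply: filterE => i /=; exact: powR_ge0.
Qed.

Definition nneg_pow (x : nnegH) (r : posFin) : nnegH := NNegH (hpow_ge0 x r).

Definition gpow (mu : PR) (r : posFin) : PR := gclass (nneg_pow (grep mu) r).

Lemma hpowM x y z : 0 <= x -> 0 <= y -> hpow (x * y) z = hpow x z * hpow y z.
Proof.
elim/hclassW: x => s; elim/hclassW: y => t; elim/hclassW: z => v.
rewrite !(hclass0, hclassM, hclass_pow, hclass_le) => /asboolP s0 /asboolP t0.
by apply/hclassP; move: s0 t0; apply: filterS2 => i /=; exact: powRM.
Qed.

Lemma posfin_hpow (c r : posFin) : posfin (hpow c r).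
Proof.
have r0 := posFin_gt0 r; have := posfin_valP r; have := posfin_valP c.
case: c r r0 => c _ [r _] /= r0.
move=> /posfinP [n /andP[nc cn]] /posfinP [m /andP[_ rm]].
apply/posfinP; exists (n.+1 ^ m.+1).-1; rewrite prednK ?expn_gt0 //.
move: r0 nc cn rm; elim/hclassW: c => s; elim/hclassW: r => t.
rewrite hclass_pow !hclass_nat !hclassV hclass0 !hclass_lt !hclass_le.
move=> /asboolP t0 /asboolP ns /asboolP sn /asboolP tm.
have n1 : 1 <= n.+1%:R :> R by rewrite ler1n.
apply/andP; split; apply/asboolP; move: t0 tm.
  move: ns; apply: filterS3 => i /= ns t0 tm.
  rewrite natrX -powR_mulrn ?ler0n // -powRN.
  apply: (@le_trans _ _ (n.+1%:R `^ (- t i))).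
    by apply: ler_powR => //; rewrite lerN2.
  rewrite powRN -powR_inv1 ?powR_ge0 // powRAC powR_inv1 ?ler0n //.
  by apply: ge0_ler_powR; rewrite ?nnegrE ?(ltW t0) ?invr_ge0 ?ler0n //;
    apply: le_trans ns; rewrite invr_ge0 ler0n.
have nsn : large u [set i | n.+1%:R^-1 <= s i /\ s i <= n.+1%:R].
  by move: ns sn; apply: filterS2.
move: nsn; apply: filterS3 => i /= [ns1 sn1] t0 tm.
rewrite natrX -powR_mulrn ?ler0n //.
apply: (@le_trans _ _ (n.+1%:R `^ t i)); last exact: ler_powR.
by apply: ge0_ler_powR; rewrite ?nnegrE ?(ltW t0) ?ler0n //;
  apply: le_trans ns1; rewrite invr_ge0 ler0n.
Qed.

(* [gpow] is independent of the representatives of the base; that it only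
   depends on the hyperreal class of the exponent is [hclass_pow]. *)
Lemma gpowE (x : nnegH) (r : posFin) : gpow (gclass x) r = gclass (nneg_pow x r).
Proof.
have /gclassP [c xE] := grepK (gclass x); apply/gclassP.
exists (PosFin (posfin_hpow c r)); rewrite /= xE hpowM ?nneg_valP //.
exact/ltW/posFin_gt0.
Qed.

End GrowthDecay.

Section SemiRingAut.
Context (S : pzSemiRingType).

Definition semiring_automorphism (f : S -> S) : Prop :=
  [/\ bijective f, nmod_morphism f & GRing.monoid_morphism f].

Record semiRingAut := SemiRingAut {
  aut_val :> S -> S;
  aut_valP : `[< semiring_automorphism aut_val >] }.

HB.instance Definition _ := [isSub for aut_val].
HB.instance Definition _ := [Choice of semiRingAut by <:].

Lemma autP (f : semiRingAut) : semiring_automorphism f.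
Proof. exact/asboolP/aut_valP. Qed.

Fact aut_id_subproof : `[< semiring_automorphism (@idfun S) >].
Proof. by apply/asboolP; split=> //; exists idfun. Qed.

Fact aut_comp_subproof (f g : semiRingAut) :
  `[< semiring_automorphism (f \o g) >].
Proof.
apply/asboolP; have [bf [f0 fD] [f1 fM]] := autP f.
have [bg [g0 gD] [g1 gM]] := autP g; split; first exact: bij_comp.
  by split=> [|x y] /=; rewrite ?g0 ?f0 ?gD ?fD.
by split=> [|x y] /=; rewrite ?g1 ?f1 ?gM ?fM.
Qed.

Fact aut_inv_subproof (f : semiRingAut) :
  {g : S -> S | `[< semiring_automorphism g >] & cancel g f /\ cancel f g}.
Proof.
have [bf [f0 fD] [f1 fM]] := autP f.
have /cid2 [g fg gf] : exists2 g, cancel f g & cancel g f by case: bf => g; exists g.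
exists g => //; apply/asboolP; have fI := can_inj fg; split; first by exists f.
  by split=> [|x y]; apply: fI; rewrite ?fD !gf ?f0.
by split=> [|x y]; apply: fI; rewrite ?fM !gf ?f1.
Qed.

(* The group law of the automorphism group is composition. *)
Definition aut_one : semiRingAut := SemiRingAut aut_id_subproof.
Definition aut_mul (f g : semiRingAut) : semiRingAut :=
  SemiRingAut (aut_comp_subproof f g).
Definition aut_inv (f : semiRingAut) : semiRingAut :=
  SemiRingAut (s2valP (aut_inv_subproof f)).

Fact aut_mulA : associative aut_mul.
Proof. by move=> f g h; apply/val_inj. Qed.
Fact aut_mul1 : left_id aut_one aut_mul.
Proof. by move=> f; apply/val_inj. Qed.
Fact aut_mulr1 : right_id aut_one aut_mul.
Proof. by move=> f; apply/val_inj. Qed.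
Fact aut_mulV : left_inverse aut_one aut_inv aut_mul.
Proof.
move=> f; apply/val_inj/funext => x /=.
by case: (aut_inv_subproof f) => g /= _ [].
Qed.
Fact aut_mulrV : right_inverse aut_one aut_inv aut_mul.
Proof.
move=> f; apply/val_inj/funext => x /=.
by case: (aut_inv_subproof f) => g /= _ [].
Qed.
HB.instance Definition _ :=
  isGroup.Build semiRingAut aut_mulA aut_mul1 aut_mulr1 aut_mulV aut_mulrV.

End SemiRingAut.

Definition Phi (R : realType) (u : ultrafilter) (r : posFin R u) :
  growthDecay R u -> growthDecay R u := fun mu => gpow mu r.

(* Main.v *)
Require Import Defs.
From HB Require Import structures.
From mathcomp Require Import all_boot all_order all_algebra.
From mathcomp Require Import all_classical reals sequences exp.

(** Powers with a positive finite exponent are monotone and multiplicative, so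
    they preserve maxima and products, and [(x ^ s) ^ r = x ^ (r s)] makes [Phi]
    a homomorphism with [Phi r^-1] inverse to [Phi r].  For faithfulness, if
    [s < r] the sequence [x_i = exp (i / (r_i - s_i))] satisfies
    [x_i ^ r_i / x_i ^ s_i = exp i], which is infinite because the ultrafilter
    is nonprincipal; this separates [r] from [s] even when [r - s] is
    infinitesimal. *)

Set Implicit Arguments.
Unset Strict Implicit.
Unset Printing Implicit Defensive.

Import Order.TTheory GRing.Theory Num.Theory.

Local Open Scope classical_set_scope.
Local Open Scope ring_scope.

(** If [[set n]] were large, the large sets would be exactly those containing [n], and [u] would be
    principal. *)
Lemma nonprincipal_neq (u : ultrafilter) (n : nat) :
  nonprincipal u -> large u [set i | i <> n].
Proof.
move=> hu; have [un|//] := near_ultra u (fun i => i = n).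
exfalso; apply: (hu n); apply/seteqP; split=> A.
  move=> uA; apply/principal_filterP.
  by have [i [Ai <-]] := filter_ex (filterI uA un).
by move=> /principal_filterP An; apply: filterS un => i /= ->.
Qed.

(** A tail is a finite intersection of complements of points. Large tails make a real sequence
    tending to infinity an infinite hyperreal. *)
Lemma nonprincipal_ge (u : ultrafilter) (n : nat) :
  nonprincipal u -> large u [set i | (n <= i)%N].
Proof.
move=> hu; elim: n => [|n IH]; first exact: filterE.
move: IH (nonprincipal_neq n hu); apply: filterS2 => i /= ni /eqP i_n.
by rewrite ltn_neqAle eq_sym i_n.
Qed.

Section HyperrealPower.
Context (R : realType) (u : ultrafilter).
Local Notation H := (hyperreal R u).
Implicit Types x y z : H.

(** Positivity excludes the convention that [powR] takes the value 1 at base 0 and exponent 0. *)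
Lemma hpow0 y : 0 < y -> hpow 0 y = 0.
Proof.
elim/hclassW: y => t; rewrite hclass0 hclass_lt hclass_pow => /asboolP t0.
by apply/hclassP; apply: filterS t0 => i /= ti; rewrite powR0 ?gt_eqF.
Qed.

Lemma hpow1 y : hpow 1 y = 1.
Proof.
elim/hclassW: y => t; rewrite hclass1 hclass_pow.
by apply/hclassP; apply: filterE => i /=; rewrite powR1.
Qed.

Lemma hpowr1 x : 0 <= x -> hpow x 1 = x.
Proof.
elim/hclassW: x => s; rewrite hclass0 hclass1 hclass_le hclass_pow => /asboolP s0.
by apply/hclassP; apply: filterS s0 => i /=; exact: powRr1.
Qed.

Lemma hpowrM x y z : hpow x (y * z) = hpow (hpow x y) z.
Proof.
elim/hclassW: x => s; elim/hclassW: y => t; elim/hclassW: z => v.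
rewrite hclassM !hclass_pow; congr hclass.
by apply/funext => i; rewrite powRrM.
Qed.

Lemma ler_hpow x y z : 0 <= x -> 0 <= z -> x <= y -> hpow x z <= hpow y z.
Proof.
elim/hclassW: x => s; elim/hclassW: y => t; elim/hclassW: z => v.
rewrite hclass0 !hclass_pow !hclass_le => /asboolP s0 /asboolP v0 /asboolP st.
apply/asboolP; move: s0 v0 st; apply: filterS3 => i /= s0 v0 st.
by apply: ge0_ler_powR; rewrite ?nnegrE // (le_trans s0 st).
Qed.

(** Ranging over every factor [c] lets the result refute directly that the two powers of [x] share
    an orbit. *)
Lemma exists_pow_ratio_unbounded (r s : H) : nonprincipal u -> s < r ->
  exists2 x : H, 0 <= x &
    forall c : H, hpow x r = c * hpow x s -> forall n, n%:R < c.
Proof.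
move=> hu; elim/hclassW: r => r; elim/hclassW: s => s.
rewrite hclass_lt => /asboolP sr.
(* Indices where the denominator vanishes do not matter: [s i < r i] on a large set. *)
exists (hclass u (fun i => expR (i%:R / (r i - s i)))).
  by rewrite hclass0 hclass_le; apply/asboolP; apply: filterE => i; exact: expR_ge0.
elim/hclassW=> c; rewrite !hclass_pow hclassM => /hclassP cE n.
rewrite hclass_nat hclass_lt; apply/asboolP.
move: sr cE (nonprincipal_ge n hu); apply: filterS3 => i /= sr cE ni.
suff -> : c i = expR i%:R.
  (* From [n <= i] follows [n < 1 + i <= expR i]. *)
  by apply: lt_le_trans (expR_ge1Dx _); rewrite nat1r ltr_nat ltnS.
move: cE; rewrite -!expRM => /(canLR (mulfK _)) <-; last by rewrite expR_eq0.
by rewrite -expRB -mulrBr divfK ?gt_eqF ?subr_gt0.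
Qed.

End HyperrealPower.

Section PhiRepresentation.
Context (R : realType) (u : ultrafilter).
Local Notation H := (hyperreal R u).
Local Notation PR := (growthDecay R u).
Implicit Types (r s : posFin R u) (mu nu : PR).

Lemma Phi1 mu : Phi 1%g mu = mu.
Proof.
elim/gclassW: mu => x; rewrite /Phi gpowE; congr gclass; apply/val_inj.
by rewrite /= hpowr1 // nneg_valP.
Qed.

Lemma PhiM r s mu : Phi (r * s)%g mu = Phi r (Phi s mu).
Proof.
elim/gclassW: mu => x; rewrite /Phi !gpowE; congr gclass; apply/val_inj.
by rewrite /= mulrC hpowrM.
Qed.

(** Raising [x <= c * y] to the power [r] changes the factor [c] to [hpow c r], again positive
    finite. *)
Lemma Phi_le r : {homo @Phi R u r : mu nu / (mu <= nu)%O}.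
Proof.
elim/gclassW=> x; elim/gclassW=> y /gle_class [c xy].
have c0 := ltW (posFin_gt0 c); rewrite /Phi !gpowE; apply/gle_class.
exists (PosFin (posfin_hpow c r)); rewrite /= -hpowM ?nneg_valP //.
by apply: ler_hpow; rewrite ?nneg_valP // ltW // posFin_gt0.
Qed.

Lemma Phi_automorphism r : semiring_automorphism (@Phi R u r).
Proof.
split.
- exists (@Phi R u r^-1%g) => mu; rewrite -PhiM ?mulVg ?mulgV; exact: Phi1.
- split=> [|mu nu].
    rewrite [LHS]gpowE; congr gclass; apply/val_inj.
    by rewrite /= hpow0 // posFin_gt0.
  (* A monotone map on a total order preserves maxima, hence tropical sums. *)
  rewrite /GRing.add /= /gadd; have [le|/ltW le] := leP mu nu.
    by rewrite max_r // Phi_le.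
  by rewrite max_l // Phi_le.
- split=> [|mu nu].
    by rewrite [LHS]gpowE; congr gclass; apply/val_inj; rewrite /= hpow1.
  elim/gclassW: mu => x; elim/gclassW: nu => y.
  rewrite [_ * _]gmulE /Phi !gpowE [RHS]gmulE; congr gclass; apply/val_inj.
  by rewrite /= hpowM ?nneg_valP.
Qed.

Lemma Phi_eq_le r s : nonprincipal u -> @Phi R u r = @Phi R u s -> (r : H) <= (s : H).
Proof.
move=> hu rs; rewrite leNgt; apply/negP => sr.
have [x x0 xP] := exists_pow_ratio_unbounded hu sr.
have := congr1 (fun f => f (gclass (NNegH x0))) rs.
(* The symmetry orients the orbit relation as [hpow x r = c * hpow x s], which makes the positive
   finite [c] infinite. *)
rewrite /Phi !gpowE => /esym/gclassP [c /= /xP cinf].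
have /posfinP [n /andP[_ cn]] := posfin_valP c.
by have := lt_le_trans (cinf n.+1) cn; rewrite ltxx.
Qed.

Lemma Phi_inj : nonprincipal u -> injective (@Phi R u).
Proof.
move=> hu r s rs; apply/val_inj/eqP.
by rewrite eq_le (Phi_eq_le hu rs) (Phi_eq_le hu (esym rs)).
Qed.

Definition Phi_aut r : semiRingAut PR := SemiRingAut (asboolT (Phi_automorphism r)).

Fact Phi_autM : {morph Phi_aut : r s / (r * s)%g}.
Proof. by move=> r s; apply/val_inj/funext => mu /=; exact: PhiM. Qed.

Fact Phi_aut1 : Phi_aut 1%g = 1%g.
Proof. by apply/val_inj/funext => mu /=; exact: Phi1. Qed.

HB.instance Definition _ :=
  isMultiplicative.Build (posFin R u) (semiRingAut PR) Phi_aut Phi_autM.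
HB.instance Definition _ :=
  Multiplicative_isUMagmaMorphism.Build (posFin R u) (semiRingAut PR) Phi_aut
    Phi_aut1.

End PhiRepresentation.

Theorem theorem2p6 (R : realType) (u : ultrafilter) (hu : nonprincipal u) :
  (forall r : posFin R u, semiring_automorphism (@Phi R u r)) /\
  (exists rho : UMagmaMorphism.type (posFin R u) (semiRingAut (growthDecay R u)),
    (forall r : posFin R u, aut_val (rho r) = @Phi R u r) /\ injective rho).
Proof.
split; first exact: Phi_automorphism.
exists (@Phi_aut R u : UMagmaMorphism.type _ _); split=> // r s.
by move=> /(congr1 (@aut_val _)); exact: Phi_inj.
Qed.
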